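(* Let $F$ be a field of characteristic $\neq 2$, let $V$ be an $n$-dimensional vector space over $F$, let $Q$ be a nondegenerate symmetric bilinear form on $V$, and let $\{e_1,\dots,e_n\}$ be a $Q$-orthogonal basis of $V$. Let $\mathfrak{G} = \{\xi \in C\ell(V,Q) : c(\xi) = -\xi\}$ with Killing form $B$. Let $I, J \in \mathfrak{I}$ with $e_I, e_J \in \mathfrak{G}$. Then: 1) $B(e_I, e_J) = \overline{Q}(e_I, e_J) = 0$ if $I \neq J$. 2) $B(e_I, e_I) = 4 m_I e_I^2$, where $m_I$ is the number of $K\in\mathfrak{I}$ with $e_K \in \mathfrak{G}$ such that $(\mathrm{ad}\, e_I)^2(e_K)$ is nonzero. 3) $\overline{Q}(e_I, e_I) = -e_I^2$.
   Context: $C\ell(V,Q)$ is the Clifford algebra: the universal associative unital $F$-algebra containing $V$ in which $v\cdot v = -Q(v,v)1$ for all $v\in V$. The map $c$ is the unique algebra anti-automorphism of $C\ell(V,Q)$ with $c(v)=-v$ for all $v\in V$. $\mathfrak{I}$ is the set of multi-indices $I=(i_1,\dots,i_k)$ with $1\le k\le n$ and $1\le i_1<\dots<i_k\le n$, and $e_I = e_{i_1}\cdots e_{i_k}$. The set $\{1\}\cup\{e_I : I\in\mathfrak{I}\}$ is a basis of $C\ell(V,Q)$; $p(x)\in F$ denotes the coefficient of $1$ in $x$ (independent of the orthogonal basis), and $\overline{Q}(x,y) = p(x\cdot c(y))$, a nondegenerate symmetric bilinear form on $C\ell(V,Q)$. Each $e_I^2$ is a nonzero element of $F$. $\mathfrak{G}$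 is a Lie algebra over $F$ under $[x,y]=xy-yx$, and $B(\xi,\eta)=\mathrm{trace}(\mathrm{ad}\,\xi\circ \mathrm{ad}\,\eta)$ (trace over $\mathfrak{G}$). *)

(* Defs.v *)
From mathcomp Require Import all_boot all_algebra all_field.

Set Implicit Arguments.
Unset Strict Implicit.
Unset Printing Implicit Defensive.

Import GRing.Theory passmx.
Local Open Scope ring_scope.

(* The Clifford algebra is characterised, up to a unique isomorphism, by its
   universal property among all (not only finite-dimensional) unital
   F-algebras.  It is finite-dimensional, hence an falgType, so that traces
   over subspaces of it make sense. *)
Definition is_clifford (F : fieldType) (V : vectType F) (Q : {symmetric V})
    (Cl : falgType F) (iota : {linear V -> Cl}) : Prop :=
  [/\ injective iota,
      forall v, iota v * iota v = (- Q v v)%:A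
    & forall (A : algType F) (f : {linear V -> A}),
        (forall v, f v * f v = (- Q v v)%:A) ->
        exists2 g : {lrmorphism Cl -> A},
          forall v, g (iota v) = f v
        & forall h : {lrmorphism Cl -> A},
            (forall v, h (iota v) = f v) -> h =1 g].

(* Since Cl is generated by V, at most one c satisfies this. *)
Definition is_clifford_conj (F : fieldType) (V : vectType F)
    (Cl : falgType F) (iota : {linear V -> Cl}) (c : 'End(Cl)) : Prop :=
  [/\ bijective c,
      c 1 = 1,
      forall x y, c (x * y) = c y * c x
    & forall v, c (iota v) = - iota v].

(* A multi-index (i_1 < ... < i_k) with k >= 1 is encoded by the nonempty set
   {i_1, ..., i_k}. *)
Definition multi_index (n : nat) : {set {set 'I_n}} := [set I | I != set0].

Section MultiVectors.
Variables (F : fieldType) (V : vectType F) (Cl : falgType F).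
Variables (iota : {linear V -> Cl}) (n : nat) (e : n.-tuple V).

(* [enum I] lists I in increasing order, and the value at set0 is 1. *)
Definition cliff_e (I : {set 'I_n}) : Cl :=
  \prod_(i <- enum I) iota (tnth e i).

Definition cliff_basis : #|{: {set 'I_n}}|.-tuple Cl :=
  [tuple cliff_e (enum_val k) | k < #|{: {set 'I_n}}|].

(* The coefficient of 1 = cliff_e set0 in the basis of multivectors. *)
Definition cliff_p (x : Cl) : F :=
  coord cliff_basis (enum_rank (set0 : {set 'I_n})) x.

Definition cliff_Qbar (c : 'End(Cl)) (x y : Cl) : F := cliff_p (x * c y).

End MultiVectors.

Definition cliff_lie (F : fieldType) (Cl : falgType F) (c : 'End(Cl)) :
  {vspace Cl} := lker (c + \1)%VF.

Lemma mem_cliff_lie (F : fieldType) (Cl : falgType F) (c : 'End(Cl)) (x : Cl) :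
  (x \in cliff_lie c) = (c x == - x).
Proof. by rewrite memv_ker add_lfunE id_lfunE addr_eq0. Qed.

Definition ad (F : fieldType) (A : falgType F) (x : A) : 'End(A) :=
  amull x - amulr x.

Lemma adE (F : fieldType) (A : falgType F) (x y : A) : ad x y = x * y - y * x.
Proof. by rewrite add_lfunE opp_lfunE !lfunE. Qed.

Lemma cliff_lie_ad (F : fieldType) (V : vectType F) (Cl : falgType F)
    (iota : {linear V -> Cl}) (c : 'End(Cl)) (x y : Cl) :
  is_clifford_conj iota c ->
  x \in cliff_lie c -> y \in cliff_lie c -> ad x y \in cliff_lie c.
Proof.
case=> _ _ cM _; rewrite !mem_cliff_lie adE linearB /= !cM.
by move=> /eqP-> /eqP->; rewrite !mulrNN opprB.
Qed.

Definition lftrace (F : fieldType) (U : vectType F) (f : 'End(U)) : F :=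
  \tr (mxof (vbasis {:U}) (vbasis {:U}) f).

(* This is the restriction of f to G when f maps G into itself. *)
Definition lfrestrict (F : fieldType) (U : vectType F) (G : {vspace U})
    (f : 'End(U)) : 'End(subvs_of G) :=
  linfun (vsproj G \o f \o vsval).

Definition killing (F : fieldType) (A : falgType F) (G : {vspace A})
    (x y : A) : F :=
  lftrace (lfrestrict G (ad x \o ad y)%VF).

Definition cliff_m (F : fieldType) (V : vectType F) (Cl : falgType F)
    (iota : {linear V -> Cl}) (n : nat) (e : n.-tuple V) (c : 'End(Cl))
    (I : {set 'I_n}) : nat :=
  #|[set K in multi_index n | (cliff_e iota e K \in cliff_lie c)
      & ad (cliff_e iota e I) (ad (cliff_e iota e I) (cliff_e iota e K)) != 0]|.

(* Main.v *)
(* Reflecting a single e_i preserves Q, so by the universal property it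
   extends to an automorphism g_i of the Clifford algebra, with
   g_i e_K = (-1)^[i in K] e_K.  These signs separate the sets K, so the
   nonzero e_K are linearly independent; they span because their span is a
   subalgebra containing V.  The g_i thus grade the algebra by sets K under
   symmetric difference, with one-dimensional pieces F e_K.  If I <> J, then
   ad e_I \o ad e_J moves every e_K to another piece, so all its diagonal
   entries vanish; and e_I either commutes with e_K, so that (ad e_I)^2 kills
   e_K, or anticommutes with it, so that (ad e_I)^2 e_K = 4 e_I^2 e_K. *)
From HB Require Import structures.
Require Import Defs.
From mathcomp Require Import all_boot all_algebra all_field.
From mathcomp Require Import ring.

Set Implicit Arguments.
Unset Strict Implicit.
Unset Printing Implicit Defensive.

Import GRing.Theory.
Local Open Scope ring_scope.

(** * Traces computed in an arbitrary basis *)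

Lemma lftrace_basis (F : fieldType) (U : vectType F) m (X : m.-tuple U)
    (f : 'End(U)) :
  basis_of {:U} X -> lftrace f = \sum_i coord X i (f X`_i).
Proof.
move=> bX; have Em : m = \dim {:U} by rewrite (size_basis bX).
subst m; pose Y := vbasis {:U}; have bY : basis_of {:U} Y := vbasisP _.
(* Basis independence: [f] is factored as the identity after [f] with [X] as middle basis, and the
   two matrices are exchanged under the trace. *)
have -> : lftrace f = \tr (passmx.mxof X X f).
  rewrite /lftrace -[f in LHS]comp_lfun1l (passmx.mxof_comp _ _ bX).
  by rewrite mxtrace_mulC -(passmx.mxof_comp _ _ bY) // comp_lfun1r.
by apply: eq_bigr => i _; rewrite !mxE /= passmx.vecof_delta.
Qed.

(** Seen in [subvs_of G] through [vsproj], the vectors of [X] form a basis, so coordinates taken in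
    the ambient space give the diagonal of the restriction. *)
Lemma lftrace_restrict (F : fieldType) (U : vectType F) m (G : {vspace U})
    (X : m.-tuple U) (f : 'End(U)) :
  basis_of G X -> (forall i : 'I_m, f X`_i \in G) ->
  lftrace (lfrestrict G f) = \sum_i coord X i (f X`_i).
Proof.
move=> bX fG; have fX := basis_free bX.
have XG (i : 'I_m) : X`_i \in G.
  by apply: (basis_mem bX); rewrite mem_nth ?size_tuple.
pose Y := map_tuple (vsproj G) X.
have YE (i : 'I_m) : Y`_i = vsproj G X`_i by rewrite (nth_map 0) ?size_tuple.
have valY (a : 'I_m -> F) : vsval (\sum_i a i *: Y`_i) = \sum_i a i *: X`_i.
  rewrite linear_sum; apply: eq_bigr => i _.
  by rewrite linearZ /= YE vsprojK.
have fY : free Y.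
  by apply/freeP => a a0; apply: (freeP fX a); rewrite -valY a0.
have bY : basis_of {:subvs_of G} Y.
  rewrite basisEfree fY subvf size_tuple /=.
  by rewrite dimvf /dim /= (size_basis bX).
rewrite (lftrace_basis _ bY); apply: eq_bigr => i _.
rewrite lfunE /= YE vsprojK //.
rewrite {1}(coord_basis bX (fG i)) linear_sum linear_sum (bigD1 i) //=.
rewrite !linearZ /= -YE coord_free // eqxx mulr1 big1 ?addr0 // => j ji.
by rewrite !linearZ /= -YE coord_free // (negPf ji) mulr0.
Qed.

(** * Equality up to sign *)

Section UpToSign.
Variable R : pzRingType.
Implicit Types x y z : R.

(** Signs arising from reordering generators are never computed: spanning and the dichotomy between
    commuting and anticommuting only require equality up to sign. *)
Definition eqpm x y := x = y \/ x = - y.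

Lemma eqpm_refl x : eqpm x x. Proof. by left. Qed.

Lemma eqpm_sym x y : eqpm x y -> eqpm y x.
Proof. by case=> ->; [left | right; rewrite opprK]. Qed.

Lemma eqpm_trans x y z : eqpm x y -> eqpm y z -> eqpm x z.
Proof.
by case=> -> [] ->; rewrite ?opprK; [left | right | right | left].
Qed.

Lemma eqpm_opp x y : eqpm x y -> eqpm (- x) y.
Proof. by case=> ->; rewrite ?opprK; [right | left]. Qed.

Lemma eqpm_mull z x y : eqpm x y -> eqpm (z * x) (z * y).
Proof. by case=> ->; rewrite ?mulrN; [left | right]. Qed.

Lemma eqpm_mulr z x y : eqpm x y -> eqpm (x * z) (y * z).
Proof. by case=> ->; rewrite ?mulNr; [left | right]. Qed.

Lemma eqpm_comm_prod (I : Type) (x : R) (E : I -> R) (s : seq I) :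
  (forall i, eqpm (x * E i) (E i * x)) ->
  eqpm (x * \prod_(i <- s) E i) (\prod_(i <- s) E i * x).
Proof.
move=> xE; elim: s => [|i s IHs]; first by rewrite big_nil mulr1 mul1r; left.
rewrite big_cons mulrA; apply: eqpm_trans (eqpm_mulr _ (xE i)) _.
by rewrite -!mulrA; apply: eqpm_mull.
Qed.

(** Induction on [s]: its head is located in [t] and moved to the front, past the factors before
    it. *)
Lemma eqpm_prod_perm (I : eqType) (E : I -> R) (s t : seq I) :
  (forall i j, eqpm (E i * E j) (E j * E i)) -> perm_eq s t ->
  eqpm (\prod_(i <- s) E i) (\prod_(i <- t) E i).
Proof.
move=> EE; elim: s t => [|i s IHs] t.
  by move/perm_size/esym/size0nil->; left.
move=> st; have it : i \in t by rewrite -(perm_mem st) mem_head.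
case/splitPr: t / it st => t1 t2 st.
have {}/IHs IHs : perm_eq s (t1 ++ t2).
  by rewrite -(perm_cons i) (permPl st) -cat1s perm_catCA.
rewrite big_cons; apply: eqpm_trans (eqpm_mull _ IHs) _.
rewrite !big_cat /= big_cons !mulrA; apply: eqpm_mulr.
exact: eqpm_comm_prod.
Qed.

End UpToSign.

(** * Products of orthogonal generators *)

Section Clifford.
Variables (F : fieldType) (n : nat) (V : vectType F) (Q : {symmetric V}).
Variables (e : n.-tuple V) (Cl : falgType F) (iota : {linear V -> Cl}).
Hypothesis charF : 2%N \notin [pchar F].
Hypothesis ndQ : nondegenerate Q.
Hypothesis basis_e : basis_of {:V} e.
Hypothesis ortho_e :
  forall i j : 'I_n, i != j -> Q (tnth e i) (tnth e j) = 0.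
Hypothesis cliffordCl : is_clifford Q iota.

Local Notation gen i := (iota (tnth e i)).
Local Notation gprod s := (\prod_(i <- s) gen i).
Local Notation ce := (cliff_e iota e).

Lemma two_neq0 : 2%:R != 0 :> F.
Proof. by move: charF; rewrite inE. Qed.

Lemma symQ u v : Q u v = Q v u.
Proof. by rewrite hermC expr0 mul1r. Qed.

Lemma cliff_sqr v : iota v * iota v = (- Q v v)%:A.
Proof. by case: cliffordCl. Qed.

(** Polarisation: expand the square of [iota (u + v)]. *)
Lemma cliff_anticomm u v : Q u v = 0 -> iota u * iota v = - (iota v * iota u).
Proof.
move=> uv0; have QD : Q (u + v) (u + v) = Q u u + Q v v.
  by rewrite linearDl /= !linearDr /= [Q v u]symQ uv0 addr0 add0r.
apply/eqP; rewrite -addr_eq0; apply/eqP.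
have := cliff_sqr (u + v); rewrite linearD mulrDl !mulrDr !cliff_sqr QD.
rewrite opprD scalerDl -addrA => /addrI; rewrite addrA => uvD.
by apply: (addIr (- Q v v)%:A); rewrite uvD add0r.
Qed.

Lemma gen_comm i j : eqpm (gen i * gen j) (gen j * gen i).
Proof.
have [-> | ij] := eqVneq i j; first exact: eqpm_refl.
by right; apply/cliff_anticomm/ortho_e.
Qed.

Lemma gprod_perm (s t : seq 'I_n) : perm_eq s t -> eqpm (gprod s) (gprod t).
Proof. exact/eqpm_prod_perm/gen_comm. Qed.

Lemma cliff_e_comm I J : eqpm (ce I * ce J) (ce J * ce I).
Proof.
apply: eqpm_comm_prod => i; apply/eqpm_sym/eqpm_comm_prod => j.
exact: gen_comm.
Qed.

Lemma cliff_e0 : ce set0 = 1.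
Proof. by rewrite /cliff_e enum_set0 big_nil. Qed.

Lemma Q_coord v i :
  Q v (tnth e i) = coord e i v * Q (tnth e i) (tnth e i).
Proof.
rewrite {1}(coord_basis basis_e (memvf v)) linear_sumlz (bigD1 i) //= -tnth_nth.
rewrite linearZl_LR big1 ?addr0 // => j ji.
by rewrite linearZl_LR /= -tnth_nth ortho_e // mulr0.
Qed.

(** Otherwise [Q_coord] would make [tnth e i] orthogonal to all of [V], against nondegeneracy. *)
Lemma Q_diag_neq0 i : Q (tnth e i) (tnth e i) != 0.
Proof.
apply/negP => /eqP qi0; have : tnth e i \in orthov Q {:V}.
  by apply/mem_orthovP => v _; rewrite symQ Q_coord qi0 mulr0.
move/eqP: ndQ => ->; rewrite memv0; apply/negP/(basis_not0 basis_e).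
exact: mem_tnth.
Qed.

Lemma gen_unit i : gen i \is a GRing.unit.
Proof.
have q0 := Q_diag_neq0 i; apply/unitrP.
exists ((- Q (tnth e i) (tnth e i))^-1 *: gen i).
by rewrite -scalerAl -scalerAr cliff_sqr scalerA mulVf ?oppr_eq0 // scale1r.
Qed.

(** A product of invertible generators is a unit, hence nonzero. *)
Lemma cliff_e_neq0 I : ce I != 0.
Proof.
have: ce I \is a GRing.unit by apply: unitr_prod => i _; apply: gen_unit.
by apply: contraTneq => ->; rewrite unitr0.
Qed.

(** If [i] is in [I], then up to sign [ce I] starts with [gen i], and the repeated generator squares
    to a scalar. The scalar stays existential because only the span matters. *)
Lemma gen_cliff_e i I :
  exists a, gen i * ce I = a *: ce (if i \in I then I :\ i else i |: I).
Proof.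
have cons_e (J : {set _}) : i \notin J -> eqpm (gen i * ce J) (ce (i |: J)).
  move=> iJ; rewrite -[gen i * _](big_cons _ _ _ _ xpredT).
  apply: gprod_perm; apply: uniq_perm; rewrite /= ?enum_uniq ?mem_enum ?iJ //.
  by move=> j; rewrite inE !mem_enum !inE.
have opZ (x y : Cl) : eqpm x y -> exists a, x = a *: y.
  by case=> ->; [exists 1; rewrite scale1r | exists (-1); rewrite scaleN1r].
case: ifPn => iI; last exact/opZ/cons_e.
have := cons_e (I :\ i); rewrite !inE eqxx setD1K // => /(_ isT)/eqpm_sym.
move/(eqpm_mull (gen i)); rewrite mulrA cliff_sqr -scalerAl mul1r.
case/opZ => a ->; exists (a * - Q (tnth e i) (tnth e i)); by rewrite scalerA.
Qed.

(** * The multivectors span the algebra *)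

Local Notation cb := (cliff_basis iota e).

Lemma cliff_basisE (k : 'I_#|{: {set 'I_n}}|) : cb`_k = ce (enum_val k).
Proof. by rewrite -tnth_nth tnth_mktuple. Qed.

Lemma cliff_sum_reindex (a : {set 'I_n} -> F) :
  \sum_K a K *: ce K = \sum_(k < #|{: {set 'I_n}}|) a (enum_val k) *: cb`_k.
Proof.
rewrite (reindex_onto (@enum_val _ predT) enum_rank) /=; last first.
  by move=> K _; rewrite enum_rankK.
apply: eq_big => [k | k _]; first by rewrite enum_valK eqxx.
by rewrite cliff_basisE.
Qed.

Lemma cliff_e_span I : ce I \in <<cb>>%VS.
Proof.
rewrite -[I]enum_rankK -cliff_basisE; apply/memv_span/mem_nth.
by rewrite size_tuple.
Qed.

(** By linearity [x] may be taken to be a product of generators, which are then multiplied onto [y]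
    one at a time with [gen_cliff_e]. *)
Lemma cliff_span_mull x y : x \in <<cb>>%VS -> y \in <<cb>>%VS ->
  x * y \in <<cb>>%VS.
Proof.
move=> xS yS; rewrite (coord_span xS) mulr_suml rpred_sum // => k _.
rewrite -scalerAl memvZ // cliff_basisE /cliff_e.
elim: (enum _) => [|i s IHs]; first by rewrite big_nil mul1r.
rewrite big_cons -mulrA; move: IHs; move: (gprod s * y) => z zS.
rewrite (coord_span zS) mulr_sumr rpred_sum // => l _.
rewrite -scalerAr memvZ // cliff_basisE.
by have [a ->] := gen_cliff_e i (enum_val l); rewrite memvZ // cliff_e_span.
Qed.

(** The universal property gives a map from [Cl] to [A]. Followed by the inclusion, it extends
    [iota] just as the identity does, so by uniqueness it is the identity and every element lies in
    [A]. *)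
Lemma clifford_generated (A : {aspace Cl}) :
  1 \in A -> (forall v, iota v \in A) -> A = {:Cl}%VS :> {vspace Cl}.
Proof.
move=> A1 iotaA; case: (cliffordCl) => _ _ univ.
pose f : {linear V -> subvs_of A} := vsproj A \o iota.
have fE v : vsval (f v) = iota v by rewrite /= vsprojK.
(* The unit of [subvs_of A] is [algid A], which equals the unit of [Cl] because [1 \in A]; the
   inclusion is thus unital. *)
have one : vsval (1 : subvs_of A) = 1.
  by apply/eqP; rewrite -[_ == _]/(algid A == 1) algid_eq1.
have [|g gE _] := univ _ f.
  move=> v; apply: val_inj; rewrite /= -[LHS]/(vsval (f v) * vsval (f v)).
  by rewrite fE cliff_sqr -{1}one.
pose h0 x := vsval (g x).
have h0L : linear h0 by move=> a x y; rewrite /h0 !linearP.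
have h0M : monoid_morphism h0.
  by split=> [|x y]; rewrite /h0 ?rmorph1 ?rmorphM // one.
pose h : {lrmorphism Cl -> Cl} := HB.pack h0
  (GRing.isLinear.Build F Cl Cl _ h0 h0L)
  (GRing.isMonoidMorphism.Build Cl Cl h0 h0M).
have [k _ kU] := univ _ iota cliff_sqr.
have hk : h =1 k by apply: kU => v; rewrite /= /h0 gE fE.
have ik : (idfun : {lrmorphism Cl -> Cl}) =1 k by apply: kU.
apply/vspaceP => x; rewrite memvf; rewrite -[x]/(idfun x) ik -hk.
exact: subvsP.
Qed.

Lemma cliff_basis_span : <<cb>>%VS = {:Cl}%VS.
Proof.
have one_span : 1 \in <<cb>>%VS by rewrite -cliff_e0 cliff_e_span.
have span_aspace : is_aspace <<cb>>%VS.
  rewrite /is_aspace has_algid1 //=; apply/prodvP => x y.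
  exact: cliff_span_mull.
apply: (clifford_generated (A := ASpace span_aspace)) => //= v.
rewrite (coord_basis basis_e (memvf v)) linear_sum rpred_sum // => i _.
rewrite linearZ memvZ //= -tnth_nth.
have := cliff_e_span [set i]; rewrite /cliff_e enum_set1 big_seq1.
by apply.
Qed.

(** * Reflections lifted to the algebra *)

Lemma clifford_reflections :
  exists g : 'I_n -> {lrmorphism Cl -> Cl},
    forall i j, g i (gen j) = (-1) ^+ (i == j) *: gen j.
Proof.
suff refl i : exists g : {lrmorphism Cl -> Cl},
    forall j, g (gen j) = (-1) ^+ (i == j) *: gen j.
  by have [g gE] := fin_all_exists refl; exists g.
(* The reflection that negates [tnth e i] and fixes the other basis vectors. *)
pose r0 v := v - (2%:R * coord e i v) *: tnth e i.
have r0L : linear r0.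
  move=> a u v; rewrite /r0 linearP /= mulrDr scalerDl opprD scalerBr.
  by rewrite scalerA mulrCA addrACA.
pose r : {linear V -> V} := HB.pack r0 (GRing.isLinear.Build F V V _ r0 r0L).
have rQ v : Q (r v) (r v) = Q v v.
  rewrite -[r v]/(v - (2%:R * coord e i v) *: tnth e i).
  move: (Q_coord v i); set a := coord e i v; set u := tnth e i => vu.
  have QB b : Q (v - b *: u) (v - b *: u) =
    Q v v - b * Q v u - b * (Q u v - b * Q u u).
    have QBr w : Q w (v - b *: u) = Q w v - b * Q w u.
      by rewrite raddfB /= linearZr_LR.
    by rewrite linearBl linearZl_LR /= !QBr.
  (* With [b] equal to [2a] and [Q v u = a * Q u u], the correction to [Q v v] is
     [(- 2a^2 - 2a^2 + 4a^2) * Q u u], which is zero. *)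
  rewrite QB (symQ u) vu; ring.
case: cliffordCl => _ _ univ.
have [v|g gE _] := univ _ (iota \o r : {linear V -> Cl}).
  by rewrite /= cliff_sqr rQ.
exists g => j; rewrite gE /= /r0 [in coord _ _ _](tnth_nth 0).
rewrite coord_free ?(basis_free basis_e) // linearB linearZ /= eq_sym.
case: eqVneq => [<- | _]; last by rewrite mulr0 scale0r subr0 expr0 scale1r.
by rewrite mulr1 scaler_nat mulr2n opprD addNKr expr1 scaleN1r.
Qed.

(** * The grading by sets of indices *)

Section Weights.
Variable g : 'I_n -> {lrmorphism Cl -> Cl}.
Hypothesis gE : forall i j, g i (gen j) = (-1) ^+ (i == j) *: gen j.
Implicit Types (x y : Cl) (I J K L : {set 'I_n}).

Definition has_weight K x := forall i, g i x = (-1) ^+ (i \in K) *: x.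

Definition symdiff I J := [set i | (i \in I) (+) (i \in J)].

Lemma cliff_e_weight K : has_weight K (ce K).
Proof.
move=> i; rewrite /cliff_e -(mem_enum K) -count_uniq_mem ?enum_uniq //.
elim: (enum K) => [|j s IHs]; first by rewrite big_nil rmorph1 scale1r.
rewrite big_cons rmorphM /= gE IHs -scalerAl -scalerAr scalerA exprD.
by rewrite [j == i]eq_sym.
Qed.

Lemma weightZ K a x : has_weight K x -> has_weight K (a *: x).
Proof. by move=> xK i; rewrite linearZ /= xK !scalerA mulrC. Qed.

Lemma weightB K x y :
  has_weight K x -> has_weight K y -> has_weight K (x - y).
Proof. by move=> xK yK i; rewrite linearB /= xK yK scalerBr. Qed.

Lemma weightM I J x y :
  has_weight I x -> has_weight J y -> has_weight (symdiff I J) (x * y).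
Proof.
move=> xI yJ i; rewrite rmorphM /= xI yJ -scalerAl -scalerAr scalerA inE.
by rewrite -signr_addb.
Qed.

Lemma symdiffC I J : symdiff I J = symdiff J I.
Proof. by apply/setP => i; rewrite !inE addbC. Qed.

Lemma ad_weight I J x y :
  has_weight I x -> has_weight J y -> has_weight (symdiff I J) (ad x y).
Proof.
move=> xI yJ; rewrite adE; apply: weightB; first exact: weightM.
by rewrite symdiffC; apply: weightM.
Qed.

(* Up to the factor 2 ^ n, applying 1 + (-1) ^+ (i \in K) g_i for all i
   projects onto the elements of weight K. *)
Lemma weight_sum_eq0 (x : {set 'I_n} -> Cl) :
  (forall L, has_weight L (x L)) -> \sum_L x L = 0 -> forall K, x K = 0.
Proof.
move=> xw x0 K.
pose p s y := foldr (fun i z => z + (-1) ^+ (i \in K) *: g i z) y s.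
(* The scalar by which the factor for [i] acts in weight [L]: 2 if [K] and [L] agree at [i], and 0
   otherwise. Hence only the term [L = K] survives, multiplied by a power of 2. *)
pose b i L : F := 1 + (-1) ^+ (i \in K) * (-1) ^+ (i \in L).
have p_sum s : p s (\sum_L x L) = \sum_L (\prod_(i <- s) b i L) *: x L.
  elim: s => [|i s IHs] /=.
    by apply: eq_bigr => L _; rewrite big_nil scale1r.
  rewrite IHs linear_sum /= scaler_sumr -big_split /=.
  apply: eq_bigr => L _; rewrite linearZ /= xw !scalerA -scalerDl big_cons.
  by rewrite mulrAC mulrDl mul1r.
have p0 s : p s 0 = 0.
  by elim: s => [//|i s IHs] /=; rewrite IHs linear0 scaler0 addr0.
have := p_sum (enum 'I_n); rewrite x0 p0 (bigD1 K) //= [X in _ + X]big1.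
  rewrite addr0 => /esym/eqP; rewrite scaler_eq0 => /orP[|/eqP //].
  rewrite big_enum prodf_seq_eq0 => /hasP[i _ /=].
  by rewrite /b -signr_addb addbb -mulr2n (negPf two_neq0).
move=> L LK; have [i iKL] : exists i, (i \in K) != (i \in L).
  apply/existsP; apply: contraNT LK; rewrite negb_exists => /forallP KL.
  by apply/eqP/setP => i; have := KL i; rewrite negbK => /eqP.
rewrite big_enum (bigD1 i) //= /b -signr_addb -negb_eqb iKL.
by rewrite expr1 subrr mul0r scale0r.
Qed.

(** The terms of a vanishing combination have distinct weights, so each vanishes separately. *)
Lemma cliff_basis_free : free cb.
Proof.
apply/freeP => a a0 k; apply/eqP.
pose c K := a (enum_rank K).
suff: c (enum_val k) *: ce (enum_val k) = 0.
  move/eqP; rewrite scaler_eq0 (negPf (cliff_e_neq0 _)) orbF.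
  by rewrite /c enum_valK.
apply: (weight_sum_eq0 (x := fun K => c K *: ce K)) => [L|].
  exact/weightZ/cliff_e_weight.
by rewrite cliff_sum_reindex -[RHS]a0; apply: eq_bigr => l _;
  rewrite /c enum_valK.
Qed.

(** Coordinates indexed by sets instead of ordinals; [cliff_coord set0] is [cliff_p]. *)
Definition cliff_coord K x := coord cb (enum_rank K) x.

Lemma cliff_coordE x : x = \sum_K cliff_coord K x *: ce K.
Proof.
rewrite cliff_sum_reindex {1}(coord_span (_ : x \in <<cb>>%VS)).
  by apply: eq_bigr => k _; rewrite /cliff_coord enum_valK.
by rewrite cliff_basis_span memvf.
Qed.

Lemma cliff_coord_e K L : cliff_coord L (ce K) = (K == L)%:R.
Proof.
rewrite -{1}[K]enum_rankK -cliff_basisE /cliff_coord.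
by rewrite coord_free ?cliff_basis_free // (inj_eq enum_rank_inj).
Qed.

Lemma cliff_coordZ K a x : cliff_coord K (a *: x) = a * cliff_coord K x.
Proof. exact: linearZ. Qed.

Lemma weight_coord K x :
  has_weight K x -> x = cliff_coord K x *: ce K.
Proof.
move=> xK; apply/eqP; rewrite eq_sym -subr_eq0; apply/eqP.
(* The expansion of [x], with [x] itself subtracted in weight [K]: homogeneous terms with sum zero,
   so the term at [K] vanishes. *)
pose y L := cliff_coord L x *: ce L - (if L == K then x else 0).
have := weight_sum_eq0 (x := y) _ _ K; rewrite /y eqxx; apply=> [L|].
  apply: weightB; first exact/weightZ/cliff_e_weight.
  by case: eqP => [-> //|_] i; rewrite linear0 scaler0.
by rewrite sumrB -cliff_coordE -big_mkcond big_pred1_eq subrr.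
Qed.

Lemma weight_coord_neq K L x :
  has_weight K x -> K != L -> cliff_coord L x = 0.
Proof.
move=> /weight_coord-> KL.
by rewrite cliff_coordZ cliff_coord_e (negPf KL) mulr0.
Qed.

(** * The Lie algebra, its Killing form and the form [cliff_Qbar] *)

Section LieAlgebra.
Variable c : 'End(Cl).
Hypothesis conj_c : is_clifford_conj iota c.
Local Notation G := (cliff_lie c).

(** [c] reverses the product and negates each generator; [gprod_perm] undoes the reversal up to
    sign. *)
Lemma conj_cliff_e K : eqpm (c (ce K)) (ce K).
Proof.
have [_ c1 cM cV] := conj_c.
have cprod s : eqpm (c (gprod s)) (gprod (rev s)).
  elim: s => [|i s IHs]; first by rewrite !big_nil c1; left.
  rewrite big_cons cM cV rev_cons big_rcons mulrN; apply: eqpm_opp.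
  exact: eqpm_mulr.
apply: eqpm_trans (cprod _) (gprod_perm _); exact/permPl/perm_rev.
Qed.

(** If [ce K] is outside [G], then [c] fixes it. As [c] is diagonal on the multivectors, [x] and
    [c x = - x] have the same coordinate at [K], which vanishes since 2 is invertible. *)
Lemma cliff_lie_coord K x :
  x \in G -> ce K \notin G -> cliff_coord K x = 0.
Proof.
rewrite !mem_cliff_lie => /eqP cx.
have [cK _|->] := conj_cliff_e K; last by rewrite eqxx.
have : cliff_coord K (c x) = cliff_coord K x.
  rewrite {1}[x]cliff_coordE linear_sum /cliff_coord linear_sum (bigD1 K) //=.
  rewrite big1 => [|L LK]; rewrite !linearZ /=.
    by rewrite cK [coord _ _ (ce K)]cliff_coord_e eqxx mulr1 addr0.
  case: (conj_cliff_e L) => ->; rewrite ?linearN /=.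
    by rewrite [coord _ _ (ce L)]cliff_coord_e (negPf LK) mulr0.
  by rewrite [coord _ _ (ce L)]cliff_coord_e (negPf LK) oppr0 mulr0.
rewrite cx /cliff_coord linearN /= => /eqP.
rewrite eq_sym -addr_eq0 -mulr2n -mulr_natl mulf_eq0 (negPf two_neq0) /=.
by move/eqP.
Qed.

(** By [cliff_lie_coord], the multivectors lying in [G] form a basis of it, and the trace is read
    off there. *)
Lemma killing_coord x y : x \in G -> y \in G ->
  killing G x y = \sum_(K | ce K \in G) cliff_coord K (ad x (ad y (ce K))).
Proof.
move=> xG yG; pose T := [set K | ce K \in G].
pose X := [tuple ce (enum_val k) | k < #|T|].
have XE (k : 'I_#|T|) : X`_k = ce (enum_val k).
  by rewrite -tnth_nth tnth_mktuple.
have sumX (a : {set 'I_n} -> F) :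
    \sum_(K in T) a K *: ce K = \sum_(k < #|T|) a (enum_val k) *: X`_k.
  by rewrite big_enum_val; apply: eq_bigr => k _; rewrite XE.
have XG (k : 'I_#|T|) : X`_k \in G.
  by rewrite XE; have := enum_valP k; rewrite inE.
have coordX (a : 'I_#|T| -> F) k :
    cliff_coord (enum_val k) (\sum_i a i *: X`_i) = a k.
  rewrite /cliff_coord linear_sum (bigD1 k) //= big1 => [|i ik].
    by rewrite linearZ /= XE [coord _ _ _]cliff_coord_e eqxx mulr1 addr0.
  rewrite linearZ /= XE [coord _ _ _]cliff_coord_e (inj_eq enum_val_inj).
  by rewrite (negPf ik) mulr0.
have bX : basis_of G X.
  apply/andP; split.
    rewrite eqEsubv; apply/andP; split; apply/subvP => z.
      by move/coord_span=> ->; rewrite rpred_sum // => i _; rewrite memvZ.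
    move=> zG; rewrite [z]cliff_coordE (bigID (mem T)) /= [X in _ + X]big1.
      rewrite addr0 sumX rpred_sum // => k _; rewrite memvZ //.
      by apply/memv_span/mem_nth; rewrite size_tuple.
    by move=> K; rewrite inE => KG; rewrite cliff_lie_coord ?scale0r.
  by apply/freeP => a a0 k; rewrite -(coordX a) a0 /cliff_coord linear0.
have adG z : z \in G -> (ad x \o ad y)%VF z \in G.
  by move=> zG; rewrite lfunE /= !(cliff_lie_ad conj_c).
rewrite /killing (lftrace_restrict bX) => [|k]; last exact: adG.
transitivity (\sum_(K in T) cliff_coord K (ad x (ad y (ce K)))); last first.
  by apply: eq_bigl => K; rewrite inE.
rewrite [RHS]big_enum_val; apply: eq_bigr => k _; rewrite -XE.
by rewrite -[in RHS]comp_lfunE [in RHS](coord_basis bX (adG _ (XG k))) coordX.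
Qed.

Lemma Qbar_coord x y :
  y \in G -> cliff_Qbar iota e c x y = - cliff_coord set0 (x * y).
Proof.
rewrite mem_cliff_lie /cliff_Qbar /cliff_p => /eqP->.
by rewrite mulrN linearN.
Qed.

(** The square has weight [symdiff I I = set0], so it is a scalar. *)
Lemma cliff_e_sqr I :
  ce I ^+ 2 = (cliff_coord set0 (ce I ^+ 2))%:A.
Proof.
rewrite -cliff_e0; apply: weight_coord; rewrite expr2.
suff <- : symdiff I I = set0 by apply: weightM; apply: cliff_e_weight.
by apply/setP => i; rewrite !inE addbb.
Qed.

(** The test [T != 0] is the one counted by [cliff_m]. In the anticommuting case one bracket gives
    [2 e_I e_K], and the second gives [2a e_K + 2a e_K]. *)
Lemma ad_ad_cliff_e I K : let T := ad (ce I) (ad (ce I) (ce K)) in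
  cliff_coord K T = if T != 0 then 4 * cliff_coord set0 (ce I ^+ 2) else 0.
Proof.
move=> T; rewrite /T !adE; case: (cliff_e_comm I K) => IK.
  by rewrite IK subrr mulr0 mul0r subrr eqxx /= /cliff_coord linear0.
set a := cliff_coord set0 _.
have -> : ce K * ce I = - (ce I * ce K) by rewrite IK opprK.
have -> : ce I * (ce I * ce K - - (ce I * ce K)) -
    (ce I * ce K - - (ce I * ce K)) * ce I = (4 * a) *: ce K.
  have IIK : ce I * (ce I * ce K) = a *: ce K.
    by rewrite mulrA -expr2 cliff_e_sqr -scalerAl mul1r.
  have IKI : ce I * ce K * ce I = - (a *: ce K).
    by rewrite -mulrA -[ce K * _]opprK -IK mulrN IIK.
  rewrite !opprK mulrDr mulrDl IIK IKI opprD opprK -!mulr2n -mulrnA.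
  by rewrite -scaler_nat scalerA.
case: eqVneq => [-> | aK0]; first by rewrite /cliff_coord linear0.
by rewrite cliff_coordZ cliff_coord_e eqxx mulr1.
Qed.

Lemma killing_sqr I : ce I \in G ->
  killing G (ce I) (ce I) =
    (4 * cliff_m iota e c I)%:R * cliff_coord set0 (ce I ^+ 2).
Proof.
move=> IG; rewrite killing_coord //.
under eq_bigr do rewrite ad_ad_cliff_e.
rewrite -big_mkcondr /= sumr_const natrM -[LHS]mulr_natr mulrAC.
congr (_ * _%:R * _); apply: eq_card => K; rewrite !inE.
(* [cliff_m] counts nonempty sets; the empty set contributes nothing to the sum either, since
   [ad (ce I)] kills [ce set0 = 1]. *)
rewrite andb_idl // => /andP[_]; apply: contraNneq => ->.
by rewrite cliff_e0 [ad _ 1]adE mulr1 mul1r subrr linear0.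
Qed.

Lemma killing_ortho I J : I != J -> ce I \in G -> ce J \in G ->
  killing G (ce I) (ce J) = 0.
Proof.
move=> IJ IG JG; rewrite killing_coord // big1 // => K _.
apply: (weight_coord_neq (K := symdiff I (symdiff J K))).
  by apply: ad_weight; last apply: ad_weight; apply: cliff_e_weight.
apply: contraNneq IJ => E; apply/eqP/setP => i.
by move/setP/(_ i): E; rewrite !inE; do 3 case: (_ \in _).
Qed.

(** The product has weight [symdiff I J], nonempty for distinct sets, so its coefficient of 1 is
    zero. *)
Lemma Qbar_ortho I J : I != J -> ce J \in G ->
  cliff_Qbar iota e c (ce I) (ce J) = 0.
Proof.
move=> IJ JG; rewrite Qbar_coord //.
rewrite (weight_coord_neq (K := symdiff I J)) ?oppr0 //.
  by apply: weightM; apply: cliff_e_weight.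
apply: contraNneq IJ => /setP E; apply/eqP/setP => i.
by have := E i; rewrite !inE; do 2 case: (_ \in _).
Qed.

End LieAlgebra.
End Weights.

End Clifford.

Theorem corollary6p10 (F : fieldType) (n : nat) (V : vectType F)
    (Q : {symmetric V}) (e : n.-tuple V)
    (Cl : falgType F) (iota : {linear V -> Cl}) (c : 'End(Cl))
    (charF : 2%N \notin [pchar F])
    (dimV : \dim {:V} = n)
    (ndQ : nondegenerate Q)
    (basis_e : basis_of {:V} e)
    (ortho_e : forall i j : 'I_n, i != j -> Q (tnth e i) (tnth e j) = 0)
    (cliffordCl : is_clifford Q iota)
    (conj_c : is_clifford_conj iota c)
    (I J : {set 'I_n})
    (mI : I \in multi_index n) (mJ : J \in multi_index n)
    (gI : cliff_e iota e I \in cliff_lie c)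
    (gJ : cliff_e iota e J \in cliff_lie c) :
  [/\ I != J ->
        killing (cliff_lie c) (cliff_e iota e I) (cliff_e iota e J)
          = cliff_Qbar iota e c (cliff_e iota e I) (cliff_e iota e J)
        /\ cliff_Qbar iota e c (cliff_e iota e I) (cliff_e iota e J) = 0,
      (killing (cliff_lie c) (cliff_e iota e I) (cliff_e iota e I))%:A
        = (4 * cliff_m iota e c I)%:R * cliff_e iota e I ^+ 2
    & (cliff_Qbar iota e c (cliff_e iota e I) (cliff_e iota e I))%:A
        = - cliff_e iota e I ^+ 2].
Proof.
have [g gE] := clifford_reflections basis_e ortho_e cliffordCl.
(* This identity turns the scalar coefficient in the formulas for both forms back into the square of
   [e_I] in [Cl]. *)
have sqrE := cliff_e_sqr charF basis_e ortho_e cliffordCl gE I.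
split.
- move=> IJ.
  have -> := Qbar_ortho charF ndQ basis_e ortho_e cliffordCl gE IJ gJ.
  by rewrite (killing_ortho charF ndQ basis_e ortho_e cliffordCl gE conj_c).
- rewrite (killing_sqr charF ndQ basis_e ortho_e cliffordCl gE conj_c gI).
  by rewrite -scalerA -sqrE scaler_nat mulr_natl.
- by rewrite Qbar_coord // scaleNr -expr2 -sqrE.
Qed.
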